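(* Let $(\mathcal{M},R,\mathcal{Y},\mathcal{O},T_1(S))$ be a framework (as defined in the context). If $T(S)$ is equicontinuous and compatible with a partial order $P$ on $\mathcal{Y}$ that satisfies the topological descending chain condition, then the following claims are equivalent: (a) Every ambiguity of $T_1(S)$ is resolvable. (a') Every ambiguity of $T_1(S)$ is resolvable relative to $P$. (b) Every element of $\overline{\mathcal{M}}$ is persistently and uniquely reducible, i.e., $\overline{\mathcal{M}}=\mathrm{Red}(S)$. (c) Every element of $\overline{\mathcal{M}}$ has a unique normal form, i.e., $\overline{\mathcal{M}}=\mathrm{Irr}(S)\oplus\mathcal{I}(S)$.
   Context: Framework. $\mathcal{M}$ is an abelian group (written additively); $R$ is a set of group endomorphisms of $\mathcal{M}$. A subgroup $N$ is called an $R$-module if $r(a)\in N$ for all $a\in N$, $r\in R$. $\mathcal{Y}\subseteq\mathcal{M}$ is such that the only $R$-module $N\subseteq\mathcal{M}$ with $\mathcal{Y}\subseteq N$ is $\mathcal{M}$ itself. $\mathcal{O}=\{B_n\}_{n=1}^\infty$ is a family of $R$-modules in $\mathcal{M}$ with $B_n\supseteq B_{n+1}$ and $\bigcap_n B_n=\{0\}$. $\mathcal{M}$ carries the group topology for which $\mathcal{O}$ is a fundamental system of neighbourhoods of $0$; $\overline{\mathcal{M}}\supseteq\mathcal{M}$ is its completion, overlines denote closure in $\overline{\mathcal{M}}$, and $\widehat{\mathcal{O}}=\{\overline{B_n}\}_{n=1}^\infty$, which is a fundamental system of neighbourhoods of $0$ in $\overline{\mathcal{M}}$. The group operations and the elements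 of $R$ are extended by continuity to $\overline{\mathcal{M}}$, and $R$-modules in $\overline{\mathcal{M}}$ are defined in the same way. $\mathrm{Span}(Z)$ is the smallest $R$-module containing $Z\subseteq\overline{\mathcal{M}}$, and $\mathrm{Cspan}(Z)=\overline{\mathrm{Span}(Z)}$. $T_1(S)$ (''simple reductions''; $S$ is just a label) is a set of continuous group homomorphisms $\overline{\mathcal{M}}\to\overline{\mathcal{M}}$, each satisfying $t\circ r=r\circ t$ for all $r\in R$. $T(S)$ (''reductions'') is the set of all finite compositions of elements of $T_1(S)$, including the identity. Reductions. $t$ acts trivially on $a$ if $t(a)=a$. $\mathrm{Irr}(S)=\{a\in\overline{\mathcal{M}}: t(a)=a\ \forall t\in T(S)\}$. $\mathcal{I}(S)=\overline{\sum_{t\in T(S)}\{a-t(a): a\in\overline{\mathcal{M}}\}}$. $a\in\mathrm{Irr}(S)$ is a normal form of $b$ if $a-b\in\mathcal{I}(S)$. An element $a$ is stuck in $N\subseteq\overline{\mathcal{M}}$ if $t(a)\in N$ for all $t\in T(S)$. For $\varepsilon\in\widehat{\mathcal{O}}$, $a$ is persistently $\varepsilon$-reducible if for every $t_1\in T(S)$ there exist $t_2\in T(S)$ and $b\in\mathrm{Irr}(S)$ such that $t_2(t_1(a))$ is stuck in $b+\varepsilon$; $a$ is persistently reducible if this holds for all $\varepsilon\in\widehat{\mathcal{O}}$. $a$ is $\varepsilon$-uniquely reducible if whenever $t_1,t_2\in T(S)$, $b_1,b_2\in\mathrm{Irr}(S)$ are such that $t_i(a)$ is stuck in $b_i+\varepsilon$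 for $i=1,2$, then $b_1+\varepsilon=b_2+\varepsilon$; it is uniquely reducible if this holds for all $\varepsilon\in\widehat{\mathcal{O}}$. $\mathrm{Red}(S)$ is the set of elements that are both persistently and uniquely reducible. A set $F$ of group homomorphisms $\overline{\mathcal{M}}\to\overline{\mathcal{M}}$ is equicontinuous if for every $\varepsilon\in\widehat{\mathcal{O}}$ there is $\delta\in\widehat{\mathcal{O}}$ with $f(\delta)\subseteq\varepsilon$ for all $f\in F$. Orders. ''$\nu<\mu$ in $P$'' is the strict relation of $P$. $P$ satisfies the topological descending chain condition (TDCC) if every infinite sequence $\{\mu_n\}_{n=0}^\infty\subseteq\mathcal{Y}$ with $\mu_n>\mu_{n+1}$ in $P$ for all $n$ satisfies $\lim_n\mu_n=0$. $\mathrm{DSM}(\mu,P)=\mathrm{Cspan}(\{\nu\in\mathcal{Y}:\nu<\mu\text{ in }P\})$. A reduction $t$ is compatible with $P$ if $t(\mu)\in\{\mu\}\cup\mathrm{DSM}(\mu,P)$ for all $\mu\in\mathcal{Y}$; a set of reductions is compatible with $P$ if all its elements are. $\mathrm{DIS}(\mu,P,S)=\mathrm{Cspan}(\{\nu-t(\nu): \nu\in\mathcal{Y},\ \nu<\mu\text{ in }P,\ t\in T_1(S)\})$. Ambiguities. An ambiguity of $T_1(S)$ is a triplet $(t_1,\mu,t_2)$ where $t_1,t_2\in T_1(S)$ both act nontrivially on $\mu\in\mathcal{Y}$. It is resolvable if for every $\varepsilon\in\widehat{\mathcal{O}}$ there exist $t_3,t_4\in T(S)$ with $t_3(t_1(\mu))-t_4(t_2(\mu))\in\varepsilon$.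 It is resolvable relative to $P$ if $t_1(\mu)-t_2(\mu)\in\mathrm{DIS}(\mu,P,S)$. *)

(* Defs.v *)
From HB Require Import structures.
From mathcomp Require Import all_boot all_order all_algebra.
From mathcomp Require Import all_classical all_reals all_analysis.

Set Implicit Arguments.
Unset Strict Implicit.
Unset Printing Implicit Defensive.

Import GRing.Theory.
Local Open Scope classical_set_scope.
Local Open Scope ring_scope.

Section Groups.
Variable V : zmodType.
Implicit Types (R : set (V -> V)) (N A B : set V).

Definition is_subgroup N : Prop :=
  N 0 /\ (forall a b, N a -> N b -> N (a - b)).

Definition is_Rmodule R N : Prop :=
  is_subgroup N /\ (forall r a, R r -> N a -> N (r a)).

Definition coset (b : V) N : set V := [set b + e | e in N].

(* Internal direct sum, for subgroups A and B of V. *)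
Definition is_direct_sum A B : Prop :=
  [set a + b | a in A & b in B] = [set: V] /\ A `&` B = [set 0].

End Groups.

(* [j] exhibits [Mbar] as the Hausdorff completion of the topological group
   [M].  Uniform continuity of the group operations forces the uniformity of
   a [UniformZmodule] to be the one attached to its group topology, so [cauchy]
   is the usual notion of Cauchy filter of a topological group. *)
Record is_completion (M : topologicalZmodType) (Mbar : UniformZmodule.type)
    (j : M -> Mbar) : Prop := IsCompletion {
  completion_morph : zmod_morphism j;
  completion_inj : injective j;
  completion_initial : forall U : set M,
    nbhs 0 U <-> exists2 W : set Mbar, nbhs 0 W & j @^-1` W `<=` U;
  completion_dense : closure (range j) = [set: Mbar];
  completion_hausdorff : hausdorff_space Mbar;
  completion_complete : forall G : set_system Mbar,
    ProperFilter G -> cauchy G -> exists l : Mbar, G --> l }.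

(* The extensions by continuity to [Mbar] of the elements of [R]; the
   extension of each r is unique because [j] is dense and [Mbar] Hausdorff. *)
Definition continuous_extensions (M : topologicalZmodType)
    (Mbar : UniformZmodule.type) (j : M -> Mbar) (R : set (M -> M)) :
    set (Mbar -> Mbar) :=
  [set rb | continuous rb /\
            exists2 r, R r & forall x : M, rb (j x) = j (r x)].

(* The completion, fixed up to isomorphism by [is_completion], is part of the
   data; M is regarded as a subgroup of it through [incl].  The sequence
   B_1, B_2, ... is indexed from 0. *)
Record framework (M : topologicalZmodType) (Mbar : UniformZmodule.type) :=
  Framework {
    incl : M -> Mbar;
    R : set (M -> M);
    Y : set M;
    B : nat -> set M;
    T1 : set (Mbar -> Mbar);
    R_morph : forall r, R r -> zmod_morphism r;
    Y_generates : forall N, is_Rmodule R N -> Y `<=` N -> N = [set: M];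
    B_Rmodule : forall n, is_Rmodule R (B n);
    B_decreasing : forall n, B n.+1 `<=` B n;
    B_separated : \bigcap_n B n = [set 0];
    B_topology : forall U : set M, nbhs 0 U <-> exists n, B n `<=` U;
    incl_completion : is_completion incl;
    T1_morph : forall t, T1 t -> zmod_morphism t;
    T1_continuous : forall t, T1 t -> continuous t;
    T1_commute : forall t r, T1 t -> continuous_extensions incl R r ->
      t \o r = r \o t }.

Section Framework.
Variables (M : topologicalZmodType) (Mbar : UniformZmodule.type).
Variable F : framework M Mbar.
Implicit Types (a b : Mbar) (t : Mbar -> Mbar) (mu nu : M) (eps Z : set Mbar).

Notation iota := (incl F).

Definition Rbar : set (Mbar -> Mbar) := continuous_extensions iota (R F).

Definition Ohat : set (set Mbar) := range (fun n => closure (iota @` B F n)).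

Definition Span Z : set Mbar := smallest (is_Rmodule Rbar) Z.

Definition Cspan Z : set Mbar := closure (Span Z).

Inductive T : (Mbar -> Mbar) -> Prop :=
  | T_id : T idfun
  | T_comp t u : T1 F t -> T u -> T (t \o u).

Definition Irr : set Mbar := [set a | forall t, T t -> t a = a].

(* The sum over T of the subgroups {a - t a}: all finite sums of their
   elements. *)
Definition sum_differences : set Mbar :=
  [set x | exists (n : nat) (t : 'I_n -> Mbar -> Mbar) (a : 'I_n -> Mbar),
     (forall i, T (t i)) /\ x = \sum_(i < n) (a i - t i (a i))].

Definition Ideal : set Mbar := closure sum_differences.

Definition normal_form a b : Prop := Irr a /\ Ideal (a - b).

Definition stuck_in a (N : set Mbar) : Prop := forall t, T t -> N (t a).

Definition persistently_eps_reducible eps a : Prop :=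
  forall t1, T t1 -> exists t2 b,
    [/\ T t2, Irr b & stuck_in (t2 (t1 a)) (coset b eps)].

Definition persistently_reducible a : Prop :=
  forall eps, Ohat eps -> persistently_eps_reducible eps a.

Definition eps_uniquely_reducible eps a : Prop :=
  forall t1 t2 b1 b2, T t1 -> T t2 -> Irr b1 -> Irr b2 ->
    stuck_in (t1 a) (coset b1 eps) -> stuck_in (t2 a) (coset b2 eps) ->
    coset b1 eps = coset b2 eps.

Definition uniquely_reducible a : Prop :=
  forall eps, Ohat eps -> eps_uniquely_reducible eps a.

Definition Red : set Mbar :=
  [set a | persistently_reducible a /\ uniquely_reducible a].

Definition equicontinuous_set (H : set (Mbar -> Mbar)) : Prop :=
  forall eps, Ohat eps -> exists2 delta, Ohat delta &
    forall f, H f -> f @` delta `<=` eps.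

(* Order relations P are given in their reflexive form; only their values on
   Y matter. *)
Record is_partial_order (P : M -> M -> Prop) : Prop := IsPartialOrder {
  po_refl : forall x, Y F x -> P x x;
  po_antisym : forall x y, Y F x -> Y F y -> P x y -> P y x -> x = y;
  po_trans : forall x y z, Y F x -> Y F y -> Y F z ->
    P x y -> P y z -> P x z }.

Definition less_in (P : M -> M -> Prop) nu mu : Prop := P nu mu /\ nu <> mu.

Definition TDCC (P : M -> M -> Prop) : Prop :=
  forall mu : nat -> M, (forall n, Y F (mu n)) ->
    (forall n, less_in P (mu n.+1) (mu n)) -> mu @ \oo --> (0 : M).

Definition DSM mu (P : M -> M -> Prop) : set Mbar :=
  Cspan (iota @` [set nu | Y F nu /\ less_in P nu mu]).

Definition compatible t (P : M -> M -> Prop) : Prop :=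
  forall mu, Y F mu -> ([set iota mu] `|` DSM mu P) (t (iota mu)).

Definition compatible_set (H : set (Mbar -> Mbar)) (P : M -> M -> Prop) : Prop :=
  forall t, H t -> compatible t P.

Definition DIS mu (P : M -> M -> Prop) : set Mbar :=
  Cspan [set x | exists nu t, [/\ Y F nu, less_in P nu mu, T1 F t &
                                  x = iota nu - t (iota nu)]].

Definition acts_trivially t a : Prop := t a = a.

Definition ambiguity t1 mu t2 : Prop :=
  [/\ T1 F t1, T1 F t2, Y F mu,
      ~ acts_trivially t1 (iota mu) & ~ acts_trivially t2 (iota mu)].

Definition resolvable t1 mu t2 : Prop :=
  forall eps, Ohat eps -> exists t3 t4,
    [/\ T t3, T t4 & eps (t3 (t1 (iota mu)) - t4 (t2 (iota mu)))].

Definition resolvable_relative (P : M -> M -> Prop) t1 mu t2 : Prop :=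
  DIS mu P (t1 (iota mu) - t2 (iota mu)).

End Framework.

(* Main.v *)
Require Import Defs.
From HB Require Import structures.
From mathcomp Require Import all_boot all_order all_algebra.
From mathcomp Require Import all_classical all_reals all_analysis.
Set Implicit Arguments.
Unset Strict Implicit.
Unset Printing Implicit Defensive.
Import GRing.Theory.
Local Open Scope classical_set_scope.
Local Open Scope ring_scope.

(* By equicontinuity the reduction-invariant parts [core n] of the closures of
   the B_n still form a neighbourhood base at 0, and modulo [core n] being stuck
   near b just means being congruent to b.  Hence the elements that can always
   be reduced to Irr modulo [core n], and those whose reduced form is unique
   modulo [core n], form closed R-modules, so both properties need only be
   checked on Y.  There they follow by induction along P, the descending chain
   condition making a failing chain enter [core n].  When all ambiguities are
   resolvable relative to P, the differences x - t(x) of smaller x have reduced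
   form 0, which makes the two branches at each ambiguity meet.  Letting n grow,
   successive reductions converge to an exact normal form. *)

Lemma subr_interchange (V : zmodType) (x y z w : V) :
  (x - y) - (z - w) = (x - z) - (y - w).
Proof. by rewrite !opprB [w - z]addrC addrACA [- y + w]addrC. Qed.

(** * Uniform abelian groups: entourages in terms of neighbourhoods of 0 *)

Section UniformGroups.
Variable V : UniformZmodule.type.
Implicit Types (x y z : V) (W : set V).

Lemma nbhs0_entourage W :
  nbhs 0 W -> entourage [set p : V * V | W (p.1 - p.2)].
Proof.
rewrite -nbhs_entourageE => -[U eU UW].
have [[U1 U2] /= [eU1 eU2] U12] := @sub_unif_continuous V U eU.
apply: filterS (entourage_inv eU1) => -[x y] /= U1yx; apply: UW.
(* Subtracting [y] from both members of the pair [(y, x)] puts [(0, x - y)] in [U]. *)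
have := U12 ((y, x), (y, y)) (conj U1yx (entourage_refl _ eU2)).
case=> -[[a b] [c d]] /= /[swap] -[-> -> -> ->].
by rewrite subrr /xsection /= inE.
Qed.

Lemma entourage_nbhs0 (A : set (V * V)) : entourage A ->
  exists2 W, nbhs 0 W & forall x y, W (x - y) -> A (x, y).
Proof.
move=> eA.
have [[U1 U2] /= [eU1 eU2] U12] :=
  @add_unif_continuous V _ (entourage_inv eA).
exists (xsection U1 0); first by rewrite -nbhs_entourageE; exists U1.
move=> x y; rewrite /xsection /= inE => U1xy.
have := U12 ((0, x - y), (y, y)) (conj U1xy (entourage_refl _ eU2)).
by case=> -[[a b] [c d]] /= /[swap] -[-> -> -> ->]; rewrite add0r subrK.
Qed.

Lemma nbhs_sub x W : nbhs x W <-> nbhs 0 [set z | W (x - z)].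
Proof.
split.
  rewrite -{1}nbhs_entourageE => -[U /= eU UW].
  have [W0 nW0 W0U] := entourage_nbhs0 eU.
  apply: filterS nW0 => z Wz; apply: UW; rewrite /xsection /= inE.
  by apply: W0U; rewrite opprB addrC subrK.
move=> /nbhs0_entourage eW; rewrite -nbhs_entourageE.
eexists; [exact: eW|move=> y].
by rewrite /xsection /= inE /= opprB addrC subrK.
Qed.

Lemma nbhs0_subr W : nbhs 0 W ->
  exists2 W', nbhs 0 W' & forall x y, W' x -> W' y -> W (x - y).
Proof.
move=> /nbhs0_entourage/entourage_split_ex[A eA AW].
have eAi := entourage_inv eA.
have [W1 nW1 W1A] := entourage_nbhs0 eA.
have [W2 nW2 W2A] := entourage_nbhs0 eAi.
exists (W1 `&` W2); first exact: filterI.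
move=> x y [W1x _] [_ W2y]; apply: (AW (x, y)); exists 0 => /=.
  by apply: W1A; rewrite subr0.
by apply: (W2A y 0); rewrite subr0.
Qed.

Lemma nbhs_translate x W : nbhs 0 W -> nbhs x [set y | W (x - y)].
Proof.
by move=> nW; apply/nbhs_sub; apply: filterS nW => z /=; rewrite subKr.
Qed.

Lemma closure_Rmodule (H : set (V -> V)) (N : set V) :
  (forall r, H r -> continuous r) -> is_Rmodule H N ->
  is_Rmodule H (closure N).
Proof.
move=> ctsH [[N0 NB] NH]; split; [split|].
- exact: subset_closure.
- move=> x y clx cly W /nbhs_sub/nbhs0_subr[W' nW' W'W].
  have [a [Na W'a]] := clx _ (nbhs_translate x nW').
  have [b [Nb W'b]] := cly _ (nbhs_translate y nW').
  exists (a - b); split; first exact: NB.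
  by have /= := W'W _ _ W'a W'b; rewrite subr_interchange !subKr.
- move=> r x Hr clx W /(ctsH r Hr) /clx[a [Na Wa]].
  by exists (r a); split=> //; exact: NH.
Qed.

End UniformGroups.

(** * Congruence modulo a subgroup *)

Section Subgroups.
Variables (V : zmodType) (N : set V).
Hypothesis sgN : is_subgroup N.
Implicit Types x y z : V.

Lemma subgroup_opp x : N x -> N (- x).
Proof. by move=> Nx; rewrite -sub0r; apply: sgN.2 => //; exact: sgN.1. Qed.

Lemma subgroup_add x y : N x -> N y -> N (x + y).
Proof. by move=> Nx /subgroup_opp Ny; rewrite -[y]opprK; exact: sgN.2. Qed.

Lemma subgroup_refl x : N (x - x).
Proof. by rewrite subrr; exact: sgN.1. Qed.

Lemma subgroup_sym x y : N (x - y) -> N (y - x).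
Proof. by rewrite -[y - x]opprB; exact: subgroup_opp. Qed.

Lemma subgroup_trans y x z : N (x - y) -> N (y - z) -> N (x - z).
Proof. by rewrite -(subrKA y x (- z)); exact: subgroup_add. Qed.

Lemma subgroup_congr x y : N (x - y) -> N y -> N x.
Proof. by rewrite -{2}(subrK y x); exact: subgroup_add. Qed.

Lemma subgroup_sub x x' y y' :
  N (x - x') -> N (y - y') -> N ((x - y) - (x' - y')).
Proof. by move=> Nx Ny; rewrite subr_interchange; exact: sgN.2. Qed.

End Subgroups.

(** * The completion, its closed R-modules and the action of reductions *)

Section Topology.
Variables (M : topologicalZmodType) (Mbar : UniformZmodule.type).
Variable F : framework M Mbar.
Notation iota := (Defs.incl F).
Notation Bbar n := (closure (iota @` B F n)).

Let comp := incl_completion F.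

Lemma incl_sub : {morph iota : m m' / m - m'}.
Proof. exact: completion_morph comp. Qed.

Lemma incl_zero : iota 0 = 0.
Proof. by rewrite -(subrr 0) incl_sub subrr. Qed.

Lemma Rbar_continuous r : Rbar F r -> continuous r.
Proof. by case. Qed.

Lemma Bbar_module n : is_Rmodule (Rbar F) (Bbar n).
Proof.
apply: closure_Rmodule; first exact: Rbar_continuous.
have [[B0 BB] BR] := B_Rmodule F n; split; [split|].
- by exists 0; rewrite ?incl_zero.
- by move=> _ _ [a Ba <-] [b Bb <-]; exists (a - b);
  [exact: BB|exact: incl_sub].
- by move=> r _ [_ [r' Rr' rr']] [a Ba <-]; exists (r' a);
  [exact: BR|rewrite rr'].
Qed.

Let sBbar n := (Bbar_module n).1.

(** By density, each point of a small open neighbourhood [D] of 0 is a limit of points of [M] in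
    [D], and these all lie in [B F n]. *)
Lemma Bbar_nbhs n : nbhs 0 (Bbar n).
Proof.
have /(completion_initial comp)[W] : nbhs 0 (B F n).
  by apply/(B_topology F); exists n.
rewrite {1}nbhsE => -[D [oD D0] DW] WB.
apply: filterS (open_nbhs_nbhs (conj oD D0)) => x Dx U nU.
have : closure (range iota) x by rewrite (completion_dense comp).
have nD : nbhs x D by apply: open_nbhs_nbhs.
move=> /(_ _ (filterI nU nD))[_ [[m _ <-] [Um Dm]]].
by exists (iota m); split=> //; exists m => //; apply: WB; exact: DW.
Qed.

Lemma Bbar_basis W : nbhs 0 W -> exists n, Bbar n `<=` W.
Proof.
move=> /nbhs0_subr[W' nW' W'W].
have /(B_topology F)[n BW] : nbhs 0 (iota @^-1` W').
  by apply/(completion_initial comp); exists W'.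
exists n => x clx.
have [_ [[m Bm <-] /= W'x]] := clx _ (nbhs_translate x nW').
rewrite -[x](addrNK (iota m)) -[iota m in X in W (_ + X)]opprK.
apply: W'W => //.
rewrite -sub0r -incl_zero -incl_sub; apply: BW; apply: (B_Rmodule F n).1.2 Bm.
exact: (B_Rmodule F n).1.1.
Qed.

Lemma Bbar_decr m n : (m <= n)%N -> Bbar n `<=` Bbar m.
Proof.
move=> /subnK <-; elim: (n - m)%N => [//|k IH]; rewrite addSn.
apply: subset_trans IH; apply: closure_subset; apply: image_subset.
exact: B_decreasing.
Qed.

(** An open subgroup is closed: a point of [M] close enough to [B F n] differs from one of its
    elements by an element of [B F n]. *)
Lemma Bbar_incl n m : Bbar n (iota m) -> B F n m.
Proof.
move=> clm; have /(completion_initial comp)[W nW WB] : nbhs 0 (B F n).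
  by apply/(B_topology F); exists n.
have [_ [[m' Bm' <-] /= Wm]] := clm _ (nbhs_translate (iota m) nW).
rewrite -incl_sub in Wm.
exact: (subgroup_congr (B_Rmodule F n).1 (WB _ Wm) Bm').
Qed.

Lemma closure_BbarP (N : set Mbar) x :
  closure N x <-> forall n, exists2 a, N a & Bbar n (x - a).
Proof.
split=> [clx n|clx W /nbhs_sub/Bbar_basis[n EW]].
  by have [a [Na Ea]] := clx _ (nbhs_translate x (Bbar_nbhs n)); exists a.
have [a Na /EW /=] := clx n; rewrite subKr => Wa; by exists a.
Qed.

Lemma continuous_BbarP (f : Mbar -> Mbar) : continuous f <->
  forall x n, exists m, forall y, Bbar m (x - y) -> Bbar n (f x - f y).
Proof.
split=> [cf x n|cf x W /nbhs_sub/Bbar_basis[n EW]].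
  have /cf/nbhs_sub/Bbar_basis[m Em] := nbhs_translate (f x) (Bbar_nbhs n).
  by exists m => y /Em /=; rewrite subKr.
have [m fm] := cf x n.
apply: filterS (nbhs_translate x (Bbar_nbhs m)) => y /= /fm/EW /=.
by rewrite subKr.
Qed.

Lemma Bbar_dense x n : exists m, Bbar n (x - iota m).
Proof.
have : closure (range iota) x by rewrite (completion_dense comp).
by move=> /closure_BbarP/(_ n)[_ [m _ <-]]; exists m.
Qed.

Lemma Bbar_separated x : (forall n, Bbar n x) -> x = 0.
Proof.
move=> Ex; apply: (completion_hausdorff comp) => U W nU nW.
have /nbhs_sub/Bbar_basis[n EU] := nU.
exists 0; split; last exact: nbhs_singleton.
by rewrite -(subrr x); exact: EU.
Qed.

Lemma Bbar_complete (c : nat -> Mbar) :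
  (forall n m, (n <= m)%N -> Bbar n (c m - c n)) ->
  exists l, forall n, Bbar n (l - c n).
Proof.
move=> cc.
have : cauchy (c @ \oo).
  move=> A /entourage_nbhs0[W /Bbar_basis[n EW] WA].
  exists ([set x | Bbar n (x - c n)], [set x | Bbar n (x - c n)]).
    by split; exists n => // m /= nm; exact: cc.
  move=> [x y] [/= xn yn]; apply/WA/EW.
  by apply: (subgroup_trans (sBbar n) xn); exact: (subgroup_sym (sBbar n)).
move=> /(completion_complete comp)[l cl]; exists l => n.
(* Terms past [k] are close to the limit and terms past [n] are congruent to [c n]; the index
   [maxn k n] serves both. *)
have [k _ /(_ (maxn k n))] := cl _ (nbhs_translate l (Bbar_nbhs n)).
rewrite /= leq_maxl => /(_ isT) lk.
by apply: (subgroup_trans (sBbar n) lk); apply: cc; exact: leq_maxr.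
Qed.

(** Members of [Rbar] are only given as continuous extensions of some [r]; approximation by points
    of [M] carries the additivity of [r] over. *)
Lemma Rbar_morph r : Rbar F r -> {morph r : x y / x - y}.
Proof.
move=> [/continuous_BbarP cr [r' Rr' rE]] x y.
apply/eqP; rewrite -subr_eq0; apply/eqP/Bbar_separated => n.
have [p rp] := cr x n; have [q rq] := cr y n; have [s rs] := cr (x - y) n.
pose k := maxn s (maxn p q).
have [m xm] := Bbar_dense x k; have [m' ym'] := Bbar_dense y k.
have -> : r (x - y) - (r x - r y) =
  (r (x - y) - r (iota (m - m'))) - ((r x - r (iota m)) - (r y - r (iota m'))).
  rewrite !rE (R_morph Rr') incl_sub.
  rewrite (subr_interchange (r x)) (subr_interchange (r (x - y))).
  by rewrite subrr subr0.
apply: (sBbar n).2.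
  apply: rs; rewrite incl_sub; apply: (Bbar_decr (leq_maxl _ _) (n := k)).
  exact: (subgroup_sub (sBbar k)).
apply: (sBbar n).2.
  by apply: rp; apply: Bbar_decr xm; rewrite !leq_max leqnn !orbT.
by apply: rq; apply: Bbar_decr ym'; rewrite !leq_max leqnn !orbT.
Qed.

(** Preserving each [B F n] makes [r] uniformly continuous, hence extendable. This is what lets a
    module over [Rbar] restrict to an R-module in [M]. *)
Lemma R_extends r : R F r ->
  exists2 rb, Rbar F rb & forall m, rb (iota m) = iota (r m).
Proof.
move=> Rr.
have rE n m m' : Bbar n (iota m - iota m') -> Bbar n (iota (r m) - iota (r m')).
  rewrite -!incl_sub -(R_morph Rr) => /Bbar_incl Bm; apply: subset_closure.
  by exists (r (m - m')) => //; apply: (B_Rmodule F n).2.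
(* Requiring the bound for every approximation [m] at every level frees [l] from the sequence chosen
   to build it; continuity and the extension property then follow directly. *)
have ext x : {l | forall n m, Bbar n (x - iota m) -> Bbar n (l - iota (r m))}.
  apply: cid; have /choice[a xa] := Bbar_dense x.
  have [|l lc] := @Bbar_complete (fun n => iota (r (a n))).
    move=> n m nm; apply: rE; apply: (subgroup_trans (sBbar n) _ (xa n)).
    by apply: (subgroup_sym (sBbar n)) => //; exact: Bbar_decr (xa m).
  exists l => n m xm; apply: (subgroup_trans (sBbar n) (lc n)); apply: rE.
  by apply: (subgroup_trans (sBbar n)) xm; exact: (subgroup_sym (sBbar n)).
pose rb x := sval (ext x).
have rbE m : rb (iota m) = iota (r m).
  apply/eqP; rewrite -subr_eq0; apply/eqP/Bbar_separated => n.
  by apply: (svalP (ext (iota m))); exact: (subgroup_refl (sBbar n)).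
exists rb => //; split; last by exists r.
apply/continuous_BbarP => x n; exists n => y xy.
have [m ym] := Bbar_dense y n.
apply: (subgroup_trans (sBbar n) (y := iota (r m))).
  by apply: (svalP (ext x)); apply: (subgroup_trans (sBbar n) xy).
by apply: (subgroup_sym (sBbar n)); exact: (svalP (ext y)).
Qed.

Lemma sub_Cspan Z : Z `<=` Cspan F Z.
Proof.
by move=> x Zx; apply: subset_closure => N [_ ZN]; exact: ZN.
Qed.

Lemma Cspan_module Z : is_Rmodule (Rbar F) (Cspan F Z).
Proof.
apply: closure_Rmodule; first exact: Rbar_continuous.
split; [split|] => [N [mN _]|x y Nx Ny N mN|r x Rr Nx N mN].
- exact: mN.1.1.
- by apply: mN.1.1.2; [exact: Nx|exact: Ny].
- by apply: mN.1.2 => //; exact: Nx.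
Qed.

Lemma Cspan_min Z N : is_Rmodule (Rbar F) N -> closed N -> Z `<=` N ->
  Cspan F Z `<=` N.
Proof.
move=> mN cN ZN; apply: subset_trans cN; apply: closure_subset.
exact: smallest_sub.
Qed.

(** The trace of [N] on [M] is an R-module containing [Y], hence all of [M], which is dense. *)
Lemma full_module (N : set Mbar) : is_Rmodule (Rbar F) N -> closed N ->
  iota @` Y F `<=` N -> forall x, N x.
Proof.
move=> mN cN YN x.
have NT : iota @^-1` N = setT.
  apply: (Y_generates (f := F)); last by move=> m Ym; apply: YN; exists m.
  split; [split|].
  - by rewrite /preimage /= incl_zero; exact: mN.1.1.
  - by move=> a b Na Nb; rewrite /preimage /= incl_sub; exact: mN.1.2.
  - move=> r a /R_extends[rb Rrb rbE] Na.
    by rewrite /preimage /= -rbE; exact: mN.2.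
apply: cN.
have : closure (range iota) x by rewrite (completion_dense comp).
apply: closure_subset => _ [m _ <-].
by have : (iota @^-1` N) m by rewrite NT.
Qed.

Lemma preimage_module (f : Mbar -> Mbar) (N : set Mbar) :
  {morph f : x y / x - y} -> (forall r x, Rbar F r -> f (r x) = r (f x)) ->
  is_Rmodule (Rbar F) N -> is_Rmodule (Rbar F) (f @^-1` N).
Proof.
move=> fB fr [[N0 NB] NR]; split; [split|].
- by rewrite /preimage /= -(subrr 0) fB subrr.
- by move=> a b Na Nb; rewrite /preimage /= fB; exact: NB.
- by move=> r a Rr Na; rewrite /preimage /= fr //; exact: NR.
Qed.

Lemma T1_T t : T1 F t -> T F t.
Proof. by move=> Tt; exact: (T_comp Tt (T_id F)). Qed.

Lemma T_trans t u : T F t -> T F u -> T F (t \o u).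
Proof.
by move=> Tt Tu; elim: Tt => [//|s v Ts _ IH]; exact: (T_comp Ts IH).
Qed.

Lemma T_sub t : T F t -> {morph t : x y / x - y}.
Proof.
by elim=> [//|s u Ts _ IH] x y /=; rewrite IH (T1_morph Ts).
Qed.

Lemma T_zero t : T F t -> t 0 = 0.
Proof. by move=> Tt; rewrite -(subrr 0) (T_sub Tt) !subrr. Qed.

Lemma T_continuous t : T F t -> continuous t.
Proof.
elim=> [x|s u Ts _ IH x]; first exact: cvg_id.
by apply: continuous_comp; [exact: IH|exact: (T1_continuous Ts)].
Qed.

Lemma T_commute t r x : T F t -> Rbar F r -> t (r x) = r (t x).
Proof.
move=> + Rr; elim=> [//|s u Ts _ IH] /=.
by rewrite IH -[LHS]/((s \o r) (u x)) (T1_commute Ts Rr).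
Qed.

(** Composition applies its rightmost factor first; discarding the initial factors that fix [a]
    exposes the first move that can take part in an ambiguity. *)
Lemma T_first_move t a : T F t ->
  t a = a \/ exists s u, [/\ T1 F s, T F u, s a <> a & t a = u (s a)].
Proof.
elim=> [|s u Ts Tu [ua|[s' [u' [Ts' Tu' s'a ua]]]]]; first by left.
  rewrite /= ua; have [sa|sa] := EM (s a = a); first by left.
  by right; exists s, idfun; split=> //; exact: T_id.
right; exists s', (s \o u'); split=> //=; first exact: T_comp.
by rewrite ua.
Qed.

Lemma Irr_module : is_Rmodule (Rbar F) (Irr F).
Proof.
split; [split|].
- by move=> t; exact: T_zero.
- by move=> a b Ia Ib t Tt; rewrite (T_sub Tt) Ia // Ib.
- by move=> r a Rr Ia t Tt; rewrite T_commute // Ia.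
Qed.

Lemma Ideal_subgroup : is_subgroup (Ideal F).
Proof.
(* Over an empty set of operators a module is just a subgroup. *)
suff: is_Rmodule set0 (Ideal F) by case.
apply: closure_Rmodule => //; split=> //; split.
  exists 0%N, (fun _ => idfun), (fun _ => 0); rewrite big_ord0.
  by split=> // -[].
move=> _ _ [n [t [a [Tt ->]]]] [m [u [b [Tu ->]]]].
(* Concatenate the two families, negating the arguments of the second, since [-(b - u b)] equals
   [- b - u (- b)]. *)
exists (n + m)%N,
  (fun i : 'I_(n + m) =>
     match fintype.split i with inl j => t j | inr k => u k end),
  (fun i : 'I_(n + m) =>
     match fintype.split i with inl j => a j | inr k => - b k end); split.
  by move=> i; case: (fintype.split i).
rewrite big_split_ord /= -sumrN; congr (_ + _); apply: eq_bigr => i _.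
  by rewrite (unsplitK (inl i)).
rewrite (unsplitK (inr i)) -[- b i]sub0r (T_sub (Tu i)) subr_interchange.
by rewrite (T_zero (Tu i)) subrr sub0r.
Qed.

Lemma Ideal_difference t a : T F t -> Ideal F (a - t a).
Proof.
move=> Tt; apply: subset_closure; exists 1%N, (fun _ => t), (fun _ => a).
by rewrite big_ord_recl big_ord0 addr0.
Qed.

Lemma Ideal_min (N : set Mbar) : is_subgroup N -> closed N ->
  (forall t a, T F t -> N (a - t a)) -> Ideal F `<=` N.
Proof.
move=> sN cN NT; apply: subset_trans cN; apply: closure_subset.
move=> _ [n [t [a [Tt ->]]]]; apply: big_ind => [|x y|i _]; first exact: sN.1.
  exact: subgroup_add.
exact: NT.
Qed.

End Topology.

Section Confluence.
Variables (M : topologicalZmodType) (Mbar : UniformZmodule.type).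
Variable F : framework M Mbar.
Variable P : M -> M -> Prop.
Hypothesis poP : is_partial_order F P.
Hypothesis tdccP : TDCC F P.
Hypothesis equiT : equicontinuous_set F (T F).
Hypothesis compT : compatible_set F (T F) P.
Notation iota := (Defs.incl F).
Notation Bbar n := (closure (iota @` B F n)).

Let TB t : T F t -> {morph t : x y / x - y} := @T_sub _ _ F t.
Let TC t r x : T F t -> Rbar F r -> t (r x) = r (t x) :=
  @T_commute _ _ F t r x.

(** * Reduction-invariant neighbourhoods of 0 and induction along [P] *)

Definition core n : set Mbar := [set a | stuck_in F a (Bbar n)].

Lemma core_module n : is_Rmodule (Rbar F) (core n).
Proof.
have [[E0 EB] ER] := Bbar_module F n; split; [split|].
- by move=> t Tt; rewrite (T_zero Tt).
- move=> a b ca cb t Tt; rewrite (T_sub Tt).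
  by apply: EB; [exact: ca|exact: cb].
- by move=> r a Rr ca t Tt; rewrite (TC _ Tt Rr); apply: ER => //; exact: ca.
Qed.

Let sc n := (core_module n).1.

Lemma core_sub_Bbar n : core n `<=` Bbar n.
Proof. by move=> a /(_ _ (T_id F)). Qed.

Lemma core_T n t a : T F t -> core n a -> core n (t a).
Proof. by move=> Tt ca u Tu; apply: (ca (u \o t)); exact: T_trans. Qed.

Lemma core_decr m n : (m <= n)%N -> core n `<=` core m.
Proof. by move=> mn a ca t Tt; apply: Bbar_decr mn _ _; exact: ca. Qed.

(** Equicontinuity enters here: all reductions at once send some [Bbar m] into [Bbar n], so [core n]
    is open. *)
Lemma Bbar_sub_core n : exists m, Bbar m `<=` core n.
Proof.
have [_ [m _ <-] dm] := equiT (ex_intro2 _ _ n I erefl : Ohat F (Bbar n)).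
by exists m => a Ea t Tt; apply: (dm t Tt); exists a.
Qed.

Lemma core_separated x : (forall n, core n x) -> x = 0.
Proof.
by move=> cx; apply: (Bbar_separated (F := F)) => n; exact: core_sub_Bbar.
Qed.

(** Such an [N] is a union of cosets of the open subgroup [core n], so its complement is open
    too. *)
Lemma closed_mod_core n (N : set Mbar) :
  (forall x y, N y -> core n (x - y) -> N x) -> closed N.
Proof.
move=> Nsat x /(closure_BbarP F) clx; have [m Em] := Bbar_sub_core n.
by have [a Na /Em] := clx m; exact: Nsat.
Qed.

Lemma core_T_Irr n t a b :
  T F t -> Irr F b -> core n (a - b) -> core n (t a - b).
Proof. by move=> Tt Ib /(core_T Tt); rewrite (T_sub Tt) Ib. Qed.

Lemma less_trans x y z : Y F x -> Y F y -> Y F z ->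
  less_in P x y -> less_in P y z -> less_in P x z.
Proof.
move=> Yx Yy Yz [xy nxy] [yz nyz]; split; first exact: (po_trans poP) xy yz.
by move=> xz; apply: nyz; apply: (po_antisym poP) => //; rewrite -xz.
Qed.

(** [P] need not be well-founded, but a descending chain of counterexamples would tend to 0 and so
    meet [core n], where [Q] holds outright. *)
Lemma TDCC_induction n (Q : M -> Prop) :
  (forall mu, Y F mu -> core n (iota mu) -> Q mu) ->
  (forall mu, Y F mu ->
    (forall nu, Y F nu -> less_in P nu mu -> Q nu) -> Q mu) ->
  forall mu, Y F mu -> Q mu.
Proof.
move=> Qcore Qstep mu Ymu; apply: contrapT => nQmu.
have next (x : {x | Y F x /\ ~ Q x}) :
    exists y : {x | Y F x /\ ~ Q x}, less_in P (sval y) (sval x).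
  case: x => x /= [Yx nQx]; apply: contrapT => no; apply: nQx.
  apply: Qstep => // nu Ynu nux; apply: contrapT => nQnu; apply: no.
  by exists (exist _ nu (conj Ynu nQnu)).
have [f fP] := choice next.
pose s k := iter k f (exist _ mu (conj Ymu nQmu)).
have [m Em] := Bbar_sub_core n.
have : (fun k => sval (s k)) @ \oo --> (0 : M).
  by apply: tdccP => k; [exact: (svalP (s k)).1|exact: fP].
have nB : nbhs (0 : M) (B F m) by apply/(B_topology F); exists m.
move=> /(_ _ nB)[k _ /(_ k (leqnn k)) /= Bs].
apply: (svalP (s k)).2; apply: Qcore; first exact: (svalP (s k)).1.
by apply: Em; apply: subset_closure; exists (sval (s k)).
Qed.

(** The preimage of [DSM F mu P] under [t] is a closed R-module. It contains every generator [nu]: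
    compatibility puts the image in [DSM F nu P] if [nu] moves, and transitivity of [P] does the
    rest. *)
Lemma DSM_T t mu x : T F t -> Y F mu -> DSM F mu P x -> DSM F mu P (t x).
Proof.
move=> Tt Ymu; apply: (Cspan_min (N := t @^-1` DSM F mu P)).
- apply: preimage_module (Cspan_module _ _); first exact: (TB Tt).
  by move=> r y; exact: (TC _ Tt).
- apply: preimage_closed; last exact: closed_closure.
  by move=> y _; exact: (T_continuous Tt).
- move=> _ [nu [Ynu lnu] <-]; have [/= ->|] := compT Tt Ynu.
    by apply: sub_Cspan; exists nu.
  apply: Cspan_min => [|| _ [x' [Yx' lx'] <-]]; first exact: Cspan_module.
    exact: closed_closure.
  apply: sub_Cspan; exists x' => //; split=> //.
  exact: (less_trans Yx' Ynu Ymu).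
Qed.

(** * Existence of reduced forms modulo [core n] *)

Definition persistent n : set Mbar := [set a | forall t1, T F t1 ->
  exists t2 b, [/\ T F t2, Irr F b & core n (t2 (t1 a) - b)]].

Lemma persistent_module n : is_Rmodule (Rbar F) (persistent n).
Proof.
have [[I0 IB] IR] := Irr_module F.
split; [split|] => [t1 Tt1|a b pa pb t1 Tt1|r a Rr pa t1 Tt1].
- exists idfun, 0; split=> //; first exact: T_id.
  by rewrite (T_zero Tt1) subrr; exact: (sc n).1.
(* Reduce [a] first, then [b] from where [t2 \o t1] has taken it; the extra [t3] keeps the image of
   [a] congruent to [c]. *)
- have [t2 [c [Tt2 Ic ac]]] := pa t1 Tt1.
  have [t3 [d [Tt3 Id bd]]] := pb _ (T_trans Tt2 Tt1).
  exists (t3 \o t2), (c - d); split; [exact: T_trans|exact: IB|].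
  rewrite /= (TB Tt1) (TB Tt2) (TB Tt3) subr_interchange.
  apply: (sc n).2 => //.
  exact: core_T_Irr.
- have [t2 [c [Tt2 Ic ac]]] := pa t1 Tt1; exists t2, (r c); split=> //.
    exact: IR.
  rewrite (TC _ Tt1 Rr) (TC _ Tt2 Rr) -(Rbar_morph Rr).
  exact: (core_module n).2.
Qed.

Lemma persistent_closed n : closed (persistent n).
Proof.
apply: (@closed_mod_core n) => x y py xy t1 Tt1.
have [t2 [c [Tt2 Ic yc]]] := py t1 Tt1; exists t2, c; split=> //.
apply: (subgroup_trans (sc n) _ yc).
by rewrite -(TB Tt2) -(TB Tt1); apply: (core_T Tt2); exact: (core_T Tt1).
Qed.

(** A reduction that moves [mu] lands in [DSM F mu P], persistent by induction. If [t1] fixes [mu],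
    either [mu] is irreducible or another reduction moves it. *)
Lemma persistent_all n a : persistent n a.
Proof.
apply: (full_module (N := persistent n)) => [||_ [mu Ymu <-]].
- exact: persistent_module.
- exact: persistent_closed.
apply: (@TDCC_induction n (fun mu => persistent n (iota mu))) Ymu => {}mu Ymu.
  move=> cmu t1 Tt1; exists idfun, 0.
  split; [exact: T_id|exact: (Irr_module F).1.1|].
  by rewrite subr0; exact: (core_T Tt1).
move=> IH.
have DSMp : DSM F mu P `<=` persistent n.
  apply: Cspan_min => [||_ [nu [Ynu lnu] <-]].
  - exact: persistent_module.
  - exact: persistent_closed.
  exact: IH.
move=> t1 Tt1; have [/= ->|/DSMp/(_ _ (T_id F))//] := compT Tt1 Ymu.
have [Imu|] := EM (Irr F (iota mu)).
  exists idfun, (iota mu); split=> //; first exact: T_id.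
  exact: (subgroup_refl (sc n)).
move=> /existsNP[t] /not_implyP[Tt tmu].
have [//|/DSMp/(_ _ (T_id F))[t2 [b [Tt2 Ib tb]]]] := compT Tt Ymu.
by exists (t2 \o t), b; split=> //; exact: T_trans.
Qed.

Lemma reduces n a : exists t b, [/\ T F t, Irr F b & core n (t a - b)].
Proof. exact: (persistent_all n a (T_id F)). Qed.

(** * Uniqueness of reduced forms modulo [core n] *)

Definition confluent n : set Mbar := [set a | forall t1 t2 b1 b2,
  T F t1 -> T F t2 -> Irr F b1 -> Irr F b2 ->
  core n (t1 a - b1) -> core n (t2 a - b2) -> core n (b1 - b2)].

(** A reduced form [b] of [x - y] says nothing about [x] and [y] separately. Reducing on until a
    single [u] reduces both, to [c] and [d], makes [b] congruent to [c - d], where confluence of [x]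
    and [y] applies. The operators [r] are handled likewise. *)
Lemma confluent_module n : is_Rmodule (Rbar F) (confluent n).
Proof.
split; [split|].
- move=> t1 t2 b1 b2 Tt1 Tt2 _ _.
  rewrite (T_zero Tt1) (T_zero Tt2) => c1 c2.
  exact: (subgroup_trans (sc n) (subgroup_sym (sc n) c1) c2).
- move=> x y cx cy t1 t2 b1 b2 Tt1 Tt2 Ib1 Ib2 xy1 xy2.
  have split t b : T F t -> Irr F b -> core n (t (x - y) - b) -> exists u c d,
      [/\ T F u, Irr F c, Irr F d & [/\ core n (u x - c), core n (u y - d)
        & core n (b - (c - d))]].
    move=> Tt Ib tb.
    have [u [c [Tu Ic xc]]] := reduces n (t x).
    have [v [d [Tv Id yd]]] := reduces n (u (t y)).
    exists (v \o (u \o t)), c, d.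
    have xc' := core_T_Irr Tv Ic xc.
    split=> //; [exact: (T_trans Tv (T_trans Tu Tt))|split=> //].
    apply: (subgroup_trans (sc n) (y := v (u (t (x - y))))).
      apply: (subgroup_sym (sc n)); apply: (core_T_Irr Tv) => //.
      exact: core_T_Irr.
    by rewrite (TB Tt) (TB Tu) (TB Tv) subr_interchange; exact: (sc n).2.
  have [u1 [c1 [d1 [Tu1 Ic1 Id1 [xc1 yd1 b1E]]]]] := split t1 b1 Tt1 Ib1 xy1.
  have [u2 [c2 [d2 [Tu2 Ic2 Id2 [xc2 yd2 b2E]]]]] := split t2 b2 Tt2 Ib2 xy2.
  apply: (subgroup_trans (sc n) b1E).
  apply: (subgroup_trans (sc n) _ (subgroup_sym (sc n) b2E)).
  apply: (subgroup_sub (sc n)).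
    exact: (cx u1 u2).
  exact: (cy u1 u2).
- move=> r x Rr cx t1 t2 b1 b2 Tt1 Tt2 Ib1 Ib2 x1 x2.
  have push t b : T F t -> Irr F b -> core n (t (r x) - b) -> exists u c,
      [/\ T F u, Irr F c, core n (u x - c) & core n (b - r c)].
    move=> Tt Ib tb; have [u [c [Tu Ic xc]]] := reduces n (t x).
    exists (u \o t), c; split=> //; first exact: T_trans.
    apply: (subgroup_trans (sc n) (y := u (t (r x)))).
      by apply: (subgroup_sym (sc n)); exact: core_T_Irr.
    rewrite (TC _ Tt Rr) (TC _ Tu Rr) -(Rbar_morph Rr).
    exact: (core_module n).2.
  have [u1 [c1 [Tu1 Ic1 xc1 b1E]]] := push t1 b1 Tt1 Ib1 x1.
  have [u2 [c2 [Tu2 Ic2 xc2 b2E]]] := push t2 b2 Tt2 Ib2 x2.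
  apply: (subgroup_trans (sc n) b1E).
  apply: (subgroup_trans (sc n) _ (subgroup_sym (sc n) b2E)).
  rewrite -(Rbar_morph Rr); apply: (core_module n).2 => //.
  exact: (cx u1 u2).
Qed.

Lemma confluent_closed n : closed (confluent n).
Proof.
apply: (@closed_mod_core n) => x y cy xy t1 t2 b1 b2 Tt1 Tt2 Ib1 Ib2 x1 x2.
have move_to t b : T F t -> core n (t x - b) -> core n (t y - b).
  move=> Tt; apply: (subgroup_trans (sc n)).
  by apply: (subgroup_sym (sc n)); rewrite -(TB Tt); exact: core_T.
by apply: (cy t1 t2) => //; exact: move_to.
Qed.

Definition joinable n x y := exists t u c, [/\ T F t, T F u, Irr F c &
  core n (t x - c) /\ core n (u y - c)].

(** A common form [c] of the two first moves links [b1] to [b2], as both moves land in [DSM F mu P],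
    confluent by induction. The premise may use the induction hypothesis because relative
    resolvability yields joins only with its help. *)
Lemma confluent_all n :
  (forall mu, Y F mu ->
    (forall nu, Y F nu -> less_in P nu mu -> confluent n (iota nu)) ->
    forall s1 s2, ambiguity F s1 mu s2 ->
    joinable n (s1 (iota mu)) (s2 (iota mu))) ->
  forall a, confluent n a.
Proof.
move=> joinP a.
apply: (full_module (N := confluent n)) => [||_ [mu Ymu <-]].
- exact: confluent_module.
- exact: confluent_closed.
apply: (@TDCC_induction n (fun mu => confluent n (iota mu))) Ymu => {}mu Ymu.
  move=> cmu t1 t2 b1 b2 Tt1 Tt2 _ _.
  move=> /(subgroup_sym (sc n)) c1 /(subgroup_sym (sc n)) c2.
  apply: (sc n).2; [apply: (subgroup_congr (sc n) c1)|
    apply: (subgroup_congr (sc n) c2)]; exact: core_T.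
move=> IH t1 t2 b1 b2 Tt1 Tt2 Ib1 Ib2 m1 m2.
have DSMc : DSM F mu P `<=` confluent n.
  apply: Cspan_min => [||_ [nu [Ynu lnu] <-]].
  - exact: confluent_module.
  - exact: confluent_closed.
  exact: IH.
(* If [t] fixes [mu], then [mu] is already congruent to the irreducible [b], and [u] cannot change
   that. *)
have fixed t u b c : t (iota mu) = iota mu -> T F u -> Irr F b -> Irr F c ->
    core n (t (iota mu) - b) -> core n (u (iota mu) - c) -> core n (b - c).
  move=> -> Tu Ib Ic /(core_T_Irr Tu Ib)/(subgroup_sym (sc n)) mb.
  exact: (subgroup_trans (sc n) mb).
have [t1mu|[s1 [u1 [Ts1 Tu1 s1mu t1E]]]] := T_first_move (iota mu) Tt1.
  exact: (fixed t1 t2).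
have [t2mu|[s2 [u2 [Ts2 Tu2 s2mu t2E]]]] := T_first_move (iota mu) Tt2.
  by apply: (subgroup_sym (sc n)); exact: (fixed t2 t1).
have [t [u [c [Tt Tu Ic [tc uc]]]]] :=
  joinP mu Ymu IH s1 s2 (And5 Ts1 Ts2 Ymu s1mu s2mu).
have conf s : T1 F s -> s (iota mu) <> iota mu -> confluent n (s (iota mu)).
  by move=> Ts smu; have [//|/DSMc] := compT (T1_T Ts) Ymu.
rewrite t1E in m1; rewrite t2E in m2.
apply: (subgroup_trans (sc n) (y := c)).
  exact: (conf s1 Ts1 s1mu u1 t).
exact: (conf s2 Ts2 s2mu u u2).
Qed.

(** * Elements with zero reduced form modulo [core n] *)

Definition vanishing n : set Mbar := [set a | forall t b,
  T F t -> Irr F b -> core n (t a - b) -> core n b].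

Lemma vanishing_closed n : closed (vanishing n).
Proof.
apply: (@closed_mod_core n) => x y vy xy t b Tt Ib xb; apply: (vy t b) => //.
apply: (subgroup_trans (sc n) _ xb); apply: (subgroup_sym (sc n)).
by rewrite -(TB Tt); exact: core_T.
Qed.

(** Quantifying over all reduced forms, in place of taking the kernel of a normal form map, gives a
    module from persistence alone, before uniqueness is known. *)
Lemma vanishing_module n : is_Rmodule (Rbar F) (vanishing n).
Proof.
split; [split|].
- move=> t b Tt _; rewrite (T_zero Tt) => /(subgroup_sym (sc n)).
  by rewrite subr0.
- move=> x y vx vy t b Tt Ib tb.
  have [u [c [Tu Ic xc]]] := reduces n (t x).
  have [v [d [Tv Id yd]]] := reduces n (u (t y)).
  have cc : core n c by apply: (vx _ _ (T_trans Tu Tt)).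
  have cd : core n d by apply: (vy _ _ (T_trans Tv (T_trans Tu Tt))).
  apply: (subgroup_congr (sc n) (y := c - d)); last exact: (sc n).2.
  apply: (subgroup_trans (sc n) (y := v (u (t (x - y))))).
    apply: (subgroup_sym (sc n)); apply: (core_T_Irr Tv) => //.
    exact: core_T_Irr.
  rewrite (TB Tt) (TB Tu) (TB Tv) subr_interchange; apply: (sc n).2 => //.
  exact: core_T_Irr.
- move=> r x Rr vx t b Tt Ib tb.
  have [u [c [Tu Ic xc]]] := reduces n (t x).
  have cc : core n c by apply: (vx _ _ (T_trans Tu Tt)).
  apply: (subgroup_congr (sc n) (y := r c)); last exact: (core_module n).2.
  apply: (subgroup_trans (sc n) (y := u (t (r x)))).
    by apply: (subgroup_sym (sc n)); exact: core_T_Irr.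
  rewrite (TC _ Tt Rr) (TC _ Tu Rr) -(Rbar_morph Rr).
  exact: (core_module n).2.
Qed.

(** Under a common reduction [a] and [t a] reach [c] and [d]. Both are reduced forms of [a], so
    [c - d], to which [b] is congruent, lies in [core n]. *)
Lemma vanishing_difference n t a :
  confluent n a -> T F t -> vanishing n (a - t a).
Proof.
move=> ca Tt u b Tu Ib ub.
have [v [c [Tv Ic ac]]] := reduces n (u a).
have [w [d [Tw Id tad]]] := reduces n (v (u (t a))).
have cd : core n (c - d).
  apply: (ca (v \o u) (w \o (v \o (u \o t)))) => //.
  - exact: T_trans.
  - exact: (T_trans Tw (T_trans Tv (T_trans Tu Tt))).
apply: (subgroup_congr (sc n) _ cd).
apply: (subgroup_trans (sc n) (y := w (v (u (a - t a))))).
  apply: (subgroup_sym (sc n)); apply: (core_T_Irr Tw) => //.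
  exact: core_T_Irr.
rewrite (TB Tu) (TB Tv) (TB Tw) subr_interchange; apply: (sc n).2 => //.
exact: core_T_Irr.
Qed.

(** The single reduction [u \o t] takes [x] to [c] and [y] to [d] modulo [core n]; then [c - d] is a
    reduced form of [x - y], hence in [core n]. *)
Lemma vanishing_joinable n x y : confluent n x -> confluent n y ->
  vanishing n (x - y) -> joinable n x y.
Proof.
move=> cx cy vxy.
have [t [c [Tt Ic xc]]] := reduces n x.
have [u [d [Tu Id yd]]] := reduces n (t y).
exists (u \o t), (u \o t), d; split=> //; try exact: T_trans.
split=> //.
have xc' := core_T_Irr Tu Ic xc.
apply: (subgroup_trans (sc n) xc'); apply: (vxy (u \o t)).
- exact: T_trans.
- exact: (Irr_module F).1.2.
by rewrite /= (TB Tt) (TB Tu) subr_interchange; exact: (sc n).2.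
Qed.

Lemma relatively_resolvable_confluent :
  (forall t1 mu t2, ambiguity F t1 mu t2 -> resolvable_relative F P t1 mu t2) ->
  forall n a, confluent n a.
Proof.
move=> res n; apply: confluent_all => mu Ymu IH s1 s2 amb.
have DSMc : DSM F mu P `<=` confluent n.
  apply: Cspan_min => [||_ [nu [Ynu lnu] <-]].
  - exact: confluent_module.
  - exact: confluent_closed.
  exact: IH.
have [Ts1 Ts2 _ s1mu s2mu] := amb.
apply: vanishing_joinable.
- by have [//|/DSMc] := compT (T1_T Ts1) Ymu.
- by have [//|/DSMc] := compT (T1_T Ts2) Ymu.
apply: Cspan_min (res _ _ _ amb) => [||_ [nu [t [Ynu lnu Tt ->]]]].
- exact: vanishing_module.
- exact: vanishing_closed.
by apply: vanishing_difference (T1_T Tt); exact: IH.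
Qed.

(** * Comparison with [Red], and exact normal forms *)

Lemma confluent_Red : (forall n a, confluent n a) -> Red F = setT.
Proof.
move=> conf; apply/seteqP; split=> // a _; split.
  move=> _ [n _ <-] t1 Tt1; have [t2 [b [Tt2 Ib ab]]] := persistent_all n a Tt1.
  exists t2, b; split=> // t Tt.
  exists (t (t2 (t1 a)) - b); last by rewrite subrKC.
  by apply: core_sub_Bbar; exact: core_T_Irr.
move=> _ [n _ <-] t1 t2 b1 b2 Tt1 Tt2 Ib1 Ib2 st1 st2.
have stuck_core t b : T F t -> Irr F b -> stuck_in F (t a) (coset b (Bbar n)) ->
    core n (t a - b).
  move=> Tt Ib st u Tu; rewrite (TB Tu) Ib //.
  by have [e Ee <-] := st u Tu; rewrite addrC addKr.
have b12 : core n (b1 - b2).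
  by apply: (conf n a t1 t2) => //; exact: stuck_core.
have sBbar := (Bbar_module F n).1; have {}b12 := core_sub_Bbar b12.
apply/seteqP; split=> _ [e Ee <-].
  exists (b1 - b2 + e); last by rewrite addrA subrKC.
  exact: (subgroup_add sBbar).
exists (b2 - b1 + e); last by rewrite addrA subrKC.
by apply: (subgroup_add sBbar) => //; exact: (subgroup_sym sBbar).
Qed.

Lemma Red_confluent : Red F = setT -> forall n a, confluent n a.
Proof.
move=> RedT n a t1 t2 b1 b2 Tt1 Tt2 Ib1 Ib2 m1 m2.
have [_ uniq] : Red F a by rewrite RedT.
have core_stuck t b : Irr F b -> core n (t a - b) ->
    stuck_in F (t a) (coset b (Bbar n)).
  move=> Ib tb u Tu; exists (u (t a) - b); last by rewrite subrKC.
  by apply: core_sub_Bbar; exact: core_T_Irr.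
have := uniq (Bbar n) (ex_intro2 _ _ n I erefl) t1 t2 b1 b2 Tt1 Tt2 Ib1 Ib2
  (core_stuck _ _ Ib1 m1) (core_stuck _ _ Ib2 m2).
(* Equal cosets only put [b1 - b2] in [Bbar n]; as every reduction fixes this difference, it lies in
   [core n] as well. *)
move=> /seteqP[sub12 _] t Tt; rewrite (TB Tt) Ib1 // Ib2 //.
have [|e Ee <-] := sub12 b1; last by rewrite addrC addKr.
by exists 0; [exact: (Bbar_module F n).1.1|rewrite addr0].
Qed.

Lemma normal_form_limit a : exists c, [/\ Irr F c, Ideal F (c - a) &
  forall n, exists2 t, T F t & core n (t a - c)].
Proof.
have step (p : nat * (Mbar -> Mbar)) : exists q : (Mbar -> Mbar) * Mbar,
    T F p.2 -> [/\ T F q.1, Irr F q.2 & core p.1 (q.1 (p.2 a) - q.2)].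
  (* A dummy value where [p.2] is not a reduction makes [step] total, as [choice] demands. *)
  have [Tp|nTp] := EM (T F p.2); last by exists (idfun, 0).
  have [t [b [Tt Ib tb]]] := persistent_all p.1 a Tp.
  by exists (t, b).
have [g gP] := choice step.
(* [s n.+1] prolongs [s n] so as to bring [a] to [c n] modulo [core n]; the index of [s] runs one
   ahead of that of [c]. *)
pose s := fix s n := if n is n'.+1 then (g (n', s n')).1 \o s n' else idfun.
pose c n := (g (n, s n)).2.
have Ts n : T F (s n).
  elim: n => [|n IH] /=; first exact: T_id.
  by apply: T_trans => //; have [] := gP (n, s n) IH.
have Ic n : Irr F (c n) by have [] := gP (n, s n) (Ts n).
have score n : core n (s n.+1 a - c n) by have [] := gP (n, s n) (Ts n).
have s_c n m : (n <= m)%N -> core n (s m.+1 a - c n).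
  move=> /subnK <-; elim: (m - n)%N => [//|k IH]; rewrite addSn.
  have [Tg _ _] := gP ((k + n).+1, s (k + n).+1) (Ts _).
  exact: (core_T_Irr Tg (Ic n) IH).
have cc n m : (n <= m)%N -> core n (c m - c n).
  move=> nm; apply: (subgroup_trans (sc n) _ (s_c n m nm)).
  by apply: (subgroup_sym (sc n)); exact: core_decr nm _ (score m).
have [|l Hl] := @Bbar_complete _ _ F c.
  by move=> n m nm; apply: core_sub_Bbar; exact: cc.
(* The limit is controlled only modulo the [Bbar] subgroups; an index beyond some [k] with [Bbar k]
   inside [core n] improves this to [core n]. *)
have lc n : core n (l - c n).
  have [k Ek] := Bbar_sub_core n.
  apply: (subgroup_trans (sc n) _ (cc n (maxn n k) (leq_maxl _ _))).
  by apply: Ek; exact: Bbar_decr (leq_maxr n k) _ (Hl _).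
have sl n : core n (s n.+1 a - l).
  by apply: (subgroup_trans (sc n) (score n)); apply: (subgroup_sym (sc n)).
exists l; split; last by move=> n; exists (s n.+1).
  move=> t Tt; apply/eqP; rewrite -subr_eq0; apply/eqP/core_separated => n.
  apply: (subgroup_trans (sc n) (y := c n)); first exact: core_T_Irr.
  exact: (subgroup_sym (sc n)).
have sI := Ideal_subgroup F.
apply: closed_closure; apply/(closure_BbarP F) => n; exists (s n.+1 a - a).
  by apply: (subgroup_sym sI); exact: Ideal_difference.
rewrite subr_interchange subrr subr0; apply: core_sub_Bbar.
exact: (subgroup_sym (sc n)).
Qed.

(** Two normal forms differ by an irreducible element of the ideal. Confluence makes the ideal
    vanishing at every level, and an irreducible element is its own reduced form. *)
Lemma confluent_unique_normal_form : (forall n a, confluent n a) ->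
  forall b, exists! a, normal_form F a b.
Proof.
move=> conf b; have [c [Ic Icb _]] := normal_form_limit b.
exists c; split=> // a [Ia Iab]; apply/eqP; rewrite -subr_eq0; apply/eqP.
have sI := Ideal_subgroup F.
have Ica : Ideal F (c - a).
  by apply: (subgroup_trans sI Icb); exact: (subgroup_sym sI).
have Irrca : Irr F (c - a) by exact: (Irr_module F).1.2.
apply: core_separated => n.
have : vanishing n (c - a).
  apply: Ideal_min Ica.
  - exact: (vanishing_module n).1.
  - exact: vanishing_closed.
  - by move=> t x Tt; exact: vanishing_difference.
move=> /(_ idfun (c - a) (T_id F) Irrca); apply; exact: (subgroup_refl (sc n)).
Qed.

Lemma unique_normal_form_direct_sum :
  (forall b, exists! a, normal_form F a b) -> is_direct_sum (Irr F) (Ideal F).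
Proof.
move=> nf; have sI := Ideal_subgroup F; split; apply/seteqP; split=> //.
- move=> b _; have [a [[Ia Iab] _]] := nf b.
  exists a => //; exists (b - a); first exact: (subgroup_sym sI).
  by rewrite subrKC.
(* Both 0 and [x] are normal forms of 0. *)
- move=> x [Irrx Ix]; have [a [_ uniq]] := nf 0.
  have <- : a = x by apply: uniq; split=> //; rewrite subr0.
  apply: uniq; split; first exact: (Irr_module F).1.1.
  by rewrite subr0; exact: sI.1.
- move=> _ ->; split; [exact: (Irr_module F).1.1|exact: sI.1].
Qed.

(** Both branches converge to irreducible elements congruent to [mu] modulo the ideal, hence to the
    same one; [t3] and [t4] stop within [core n] of it. *)
Lemma direct_sum_resolvable : is_direct_sum (Irr F) (Ideal F) ->
  forall t1 mu t2, ambiguity F t1 mu t2 -> resolvable F t1 mu t2.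
Proof.
move=> [_ IrrI] t1 mu t2 [Tt1 Tt2 _ _ _] _ [n _ <-].
have sI := Ideal_subgroup F.
have [c [Ic Ic1 cP]] := normal_form_limit (t1 (iota mu)).
have [d [Id Id2 dP]] := normal_form_limit (t2 (iota mu)).
have toI t x : T1 F t -> Ideal F (x - t (iota mu)) -> Ideal F (x - iota mu).
  move=> /T1_T Tt xt; apply: (subgroup_trans sI xt).
  by apply: (subgroup_sym sI); exact: Ideal_difference.
have cd0 : [set 0] (c - d).
  rewrite -IrrI; split; first exact: (Irr_module F).1.2.
  apply: (subgroup_trans sI (toI _ _ Tt1 Ic1)); apply: (subgroup_sym sI).
  exact: toI Tt2 Id2.
have {cd0} cd : c = d by apply/eqP; rewrite -subr_eq0; apply/eqP.
have [t3 Tt3 t3c] := cP n; have [t4 Tt4 t4d] := dP n.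
exists t3, t4; split=> //; apply: core_sub_Bbar.
apply: (subgroup_trans (sc n) t3c); rewrite cd; exact: (subgroup_sym (sc n)).
Qed.

(** * From resolvability to resolvability relative to [P] *)

Lemma DIS_difference mu t x : Y F mu -> T F t -> DSM F mu P x ->
  DIS F mu P (x - t x).
Proof.
move=> Ymu Tt; elim: Tt x => [|s u Ts Tu IH] x Dx.
  by rewrite subrr; exact: (Cspan_module F _).1.1.
(* Telescoping: [x - s (u x)] is [x - u x] plus [u x - s (u x)], and [u x] is still in
   [DSM F mu P]. *)
apply: (subgroup_trans (Cspan_module F _).1 (IH x Dx)).
have : DSM F mu P (u x) by exact: DSM_T.
rewrite /=; move: (u x) => w; have Ts' := T1_T Ts.
suff: DSM F mu P `<=` (fun y => y - s y) @^-1` DIS F mu P by apply.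
apply: Cspan_min.
- apply: preimage_module (Cspan_module F _).
    by move=> y z; rewrite (TB Ts') subr_interchange.
  by move=> r y Rr; rewrite (TC _ Ts' Rr) (Rbar_morph Rr).
- apply: preimage_closed; last exact: closed_closure.
  move=> y _; move: y; apply/(continuous_BbarP F) => y n.
  have [m sm] := (continuous_BbarP F s).1 (T_continuous Ts') y n.
  exists (maxn n m) => z yz; rewrite subr_interchange.
  apply: (Bbar_module F n).1.2; first exact: Bbar_decr (leq_maxl n m) _ yz.
  by apply: sm; exact: Bbar_decr (leq_maxr n m) _ yz.
- by move=> _ [nu [Ynu lnu] <-]; apply: sub_Cspan; exists nu, s.
Qed.

Lemma resolvable_relatively_resolvable t1 mu t2 : ambiguity F t1 mu t2 ->
  resolvable F t1 mu t2 -> resolvable_relative F P t1 mu t2.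
Proof.
move=> [Tt1 Tt2 Ymu t1mu t2mu] res.
have sD := (Cspan_module F _ : is_Rmodule (Rbar F) (DIS F mu P)).1.
have D1 : DSM F mu P (t1 (iota mu)) by have [//|] := compT (T1_T Tt1) Ymu.
have D2 : DSM F mu P (t2 (iota mu)) by have [//|] := compT (T1_T Tt2) Ymu.
apply: closed_closure; apply/(closure_BbarP F) => n.
have [t3 [t4 [Tt3 Tt4 t34]]] := res (Bbar n) (ex_intro2 _ _ n I erefl).
(* This element of [DIS F mu P] differs from the difference of the branches by the resolved
   difference, which lies in [Bbar n]. *)
exists ((t1 (iota mu) - t3 (t1 (iota mu)))
  - (t2 (iota mu) - t4 (t2 (iota mu)))).
  by apply: sD.2; exact: DIS_difference.
by rewrite (subr_interchange _ (t3 _)) subKr.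
Qed.

End Confluence.

Theorem theorem5p11 (M : topologicalZmodType) (Mbar : UniformZmodule.type)
    (F : framework M Mbar) (P : M -> M -> Prop) :
  is_partial_order F P ->
  TDCC F P ->
  equicontinuous_set F (T F) ->
  compatible_set F (T F) P ->
  [<-> forall t1 mu t2, ambiguity F t1 mu t2 -> resolvable F t1 mu t2;
       forall t1 mu t2, ambiguity F t1 mu t2 -> resolvable_relative F P t1 mu t2;
       Red F = [set: Mbar];
       forall b, exists! a, normal_form F a b;
       is_direct_sum (Irr F) (Ideal F)].
Proof.
(* A single cycle of implications, in which claim (c) supplies two stops: unique normal forms and
   the direct sum. *)
move=> poP tdccP equiT compT; tfae.
- move=> res t1 mu t2 amb.
  by apply: (resolvable_relatively_resolvable poP) => //; exact: res.
- move=> rel; apply: (confluent_Red (P := P)) => //.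
  exact: (relatively_resolvable_confluent (P := P)).
- move=> RedT; apply: (confluent_unique_normal_form (P := P)) => //.
  exact: Red_confluent.
- exact: unique_normal_form_direct_sum.
- exact: (direct_sum_resolvable (P := P)).
Qed.
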